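(* Let $p\geq 2$ and let $G$ be a $2p$-regular graph. The following are equivalent: (I) $G$ admits a $(p+2)$-star colouring; (II) $G$ admits a $(p+2)$-coloured MINI-orientation; (III) $G$ has an orientation that admits an out-neighbourhood bijective homomorphism to $\vec{L}(K_{p+2})$; (IV) $G$ admits a $(p+2)$-colouring $f$ such that every bicoloured component of $(G,f)$ is isomorphic to $K_{1,p}$.
   Context: Graphs are finite and simple. A $k$-colouring of $G$ is a map $f\colon V(G)\to\mathbb{Z}_k$ with $f(u)\neq f(v)$ for every edge $uv$. A bicoloured component of $(G,f)$ is a connected component of the subgraph induced by the union of two colour classes. A $k$-star colouring is a $k$-colouring in which every bicoloured component is a star $K_{1,q}$ ($q\geq 0$). A coloured orientation of $G$ is a pair $(\vec{G},f)$ where $\vec{G}$ is an orientation of $G$ and $f$ is a colouring of $G$. It is a $q$-coloured MINI-orientation if $f$ is a $q$-colouring and for every vertex $v$: (i) no out-neighbour of $v$ has the same colour as an in-neighbour of $v$; (ii) the out-neighbours of $v$ have pairwise distinct colours; (iii) all in-neighbours of $v$ have the same colour. The oriented line graph $\vec{L}(K_q)$ has as vertices the ordered pairs $(i,j)$ of distinct elements of $\mathbb{Z}_q$, with an arc from $(i,j)$ to $(j,k)$ whenever $k\neq i$. An out-neighbourhood bijective homomorphism (OBH) from an oriented graph $\vec{G}$ to an oriented graph $\vec{H}$ is a map $\psi\colon V(\vec{G})\to V(\vec{H})$ such that for every vertex $v$ of $\vec{G}$, the restriction of $\psi$ to the out-neighbourhood $N^+_{\vec{G}}(v)$ is a bijection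 onto $N^+_{\vec{H}}(\psi(v))$. *)

(* Defs.v *)
From mathcomp Require Import all_boot.

Set Implicit Arguments.
Unset Strict Implicit.
Unset Printing Implicit Defensive.

Structure sgraph := SGraph {
  vertex :> finType;
  edge : rel vertex;
  edge_sym : symmetric edge;
  edge_irrefl : irreflexive edge
}.

Definition neighbours (G : sgraph) (v : G) : {set G} := [set w | edge v w].

Definition regular (G : sgraph) (d : nat) : Prop :=
  forall v : G, #|neighbours v| = d.

Definition isomorphic (G H : sgraph) : Prop :=
  exists2 h : G -> H, bijective h & forall u v, edge (h u) (h v) = edge u v.

Section Induced.
Variables (G : sgraph) (S : {set G}).

Definition induced_edge : rel {x : G | x \in S} :=
  fun x y => edge (val x) (val y).

Lemma induced_edge_sym : symmetric induced_edge.
Proof. by move=> x y; apply: edge_sym. Qed.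

Lemma induced_edge_irrefl : irreflexive induced_edge.
Proof. by move=> x; apply: edge_irrefl. Qed.

Definition induced : sgraph := SGraph induced_edge_sym induced_edge_irrefl.

End Induced.

Definition components (G : sgraph) : {set {set G}} :=
  equivalence_partition (connect (@edge G)) [set: G].

Section Star.
Variable q : nat.

(* The centre of the star K_{1,q} is None, its q leaves are the Some i. *)
Definition star_edge : rel (option 'I_q) :=
  fun x y => (x == None) != (y == None).

Lemma star_edge_sym : symmetric star_edge.
Proof. by move=> x y; rewrite /star_edge eq_sym. Qed.

Lemma star_edge_irrefl : irreflexive star_edge.
Proof. by move=> x; rewrite /star_edge eqxx. Qed.

Definition star : sgraph := SGraph star_edge_sym star_edge_irrefl.

End Star.

(* Colours are only labels, so Z_k is taken as 'I_k, which has exactly k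
   elements for every k (unlike 'Z_k, which has two elements for k = 0, 1);
   for k >= 2 the two types agree. *)
Definition colouring (G : sgraph) (k : nat) (f : G -> 'I_k) : Prop :=
  forall u v : G, edge u v -> f u != f v.

Definition bicoloured (G : sgraph) (k : nat) (f : G -> 'I_k) (i j : 'I_k) :
  sgraph := induced [set x : G | (f x == i) || (f x == j)].

(* Two colour classes means two distinct colours: a component inside a single
   class is an isolated vertex, never a K_{1,p} with p > 0. *)
Definition all_bicoloured_components (G : sgraph) (k : nat) (f : G -> 'I_k)
    (P : sgraph -> Prop) : Prop :=
  forall i j : 'I_k, i != j ->
  forall C : {set bicoloured f i j}, C \in components (bicoloured f i j) ->
  P (induced C).

Definition star_colouring (G : sgraph) (k : nat) (f : G -> 'I_k) : Prop :=
  colouring f /\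
  all_bicoloured_components f (fun C => exists q : nat, isomorphic C (star q)).

Definition is_oriented (V : finType) (a : rel V) : Prop :=
  forall u v : V, ~~ (a u v && a v u).

Structure ograph := OGraph {
  overtex :> finType;
  arc : rel overtex;
  arc_oriented : is_oriented arc
}.

Definition out_nbrs (D : ograph) (v : D) : {set D} := [set w | arc v w].
Definition in_nbrs (D : ograph) (v : D) : {set D} := [set u | arc u v].

Structure orientation (G : sgraph) := Orientation {
  orient : rel G;
  orient_oriented : is_oriented orient;
  orient_edge : forall u v : G, edge u v = orient u v || orient v u
}.

Definition ograph_of (G : sgraph) (o : orientation G) : ograph :=
  OGraph (@orient_oriented G o).
Coercion ograph_of : orientation >-> ograph.

Definition MINI_orientation (G : sgraph) (q : nat) (o : orientation G)
    (f : G -> 'I_q) : Prop :=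
  colouring f /\
  forall v : o,
    [/\ forall w u : o, w \in out_nbrs v -> u \in in_nbrs v -> f w != f u,
        {in out_nbrs v &, injective f}
      & {in in_nbrs v &, forall u w, f u = f w}].

Section LineGraph.
Variable q : nat.

Definition opair : finType := {x : 'I_q * 'I_q | x.1 != x.2}.

(* The condition k != i for an arc from (i, j) to (j, k). *)
Definition oline_arc : rel opair :=
  fun x y => ((val y).1 == (val x).2) && ((val y).2 != (val x).1).

Lemma oline_arc_oriented : is_oriented oline_arc.
Proof.
move=> x y; rewrite /oline_arc.
by case: eqP => //= _; apply/negP => /andP[ne /andP[/eqP eq _]]; rewrite eq eqxx in ne.
Qed.

Definition oline_K : ograph := OGraph oline_arc_oriented.

End LineGraph.

Definition OBH (D H : ograph) (psi : D -> H) : Prop :=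
  forall v : D,
    {in out_nbrs v &, injective psi} /\
    psi @: out_nbrs v = out_nbrs (psi v).

(* Main.v *)
Require Import Defs.
From mathcomp Require Import all_boot.

Set Implicit Arguments.
Unset Strict Implicit.
Unset Printing Implicit Defensive.

(** In a star colouring, orient every edge from leaf to centre of its
    bicoloured component.  Then the out-neighbours of a vertex v have distinct
    colours, which differ from those of its in-neighbours and from that of v,
    so d+(v) + #(in-colours of v) <= p + 1.  As d+(v) + d-(v) = 2p > p + 1,
    there is an in-colour, whence d+(v) <= p; since out- and in-degrees have
    the same sum, equality holds everywhere and every vertex has exactly one
    in-colour.  The OBH sends v to (in-colour of v, colour of v).  Conversely,
    given an OBH with values (g v, f v), within the colours i and j every arc
    goes from a v with g v outside {i, j} to a v with g v in {i, j}; the former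
    have one out-neighbour there and the latter p in-neighbours. *)

(** * Components and stars *)

Lemma components_connect (H : sgraph) (x : H) :
  [set y | connect (@edge H) x y] \in components H.
Proof.
apply/imsetP; exists x; rewrite ?inE //.
by apply/setP => y; rewrite !inE.
Qed.

Lemma componentsP (H : sgraph) (C : {set H}) :
  C \in components H -> exists x, C = [set y | connect (@edge H) x y].
Proof.
case/imsetP => x _ ->; exists x.
by apply/setP => y; rewrite !inE.
Qed.

(** Each edge of a star has exactly one end at the centre: if [u] is the centre then so is [b];
    otherwise [a] and [v] both are. *)
Lemma star_no_path4 (H : sgraph) q (a u v b : H) :
  isomorphic H (star q) -> edge a u -> edge u v -> edge v b -> a = v \/ u = b.
Proof.
case=> h /bij_inj inj_h hE; rewrite -!hE /edge /= /star_edge => au uv vb.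
have hN (x y : H) : h x == None -> h y == None -> x = y.
  by move=> /eqP hx /eqP hy; apply: inj_h; rewrite hx hy.
case: (boolP (h u == None)) => hu.
  right; apply: hN => //; move: uv vb; rewrite hu.
  by case: (h v == None) => //; case: (h b == None).
left; apply: hN; move: au uv; rewrite (negPf hu).
  by case: (h a == None).
by case: (h v == None).
Qed.

(** All four vertices lie in one component of the subgraph coloured [f u] and [f v], which is a
    star. *)
Lemma star_colouring_no_path4 (G : sgraph) k (f : G -> 'I_k) (a u v b : G) :
  star_colouring f -> edge a u -> edge u v -> edge v b ->
  f a = f v -> f b = f u -> a = v \/ u = b.
Proof.
case=> col comp au uv vb fa fb.
pose S := [set x : G | (f x == f u) || (f x == f v)].
have Su : u \in S by rewrite inE eqxx.
have Sv : v \in S by rewrite inE eqxx orbT.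
have Sa : a \in S by rewrite inE fa eqxx orbT.
have Sb : b \in S by rewrite inE fb eqxx.
pose B := bicoloured f (f u) (f v).
pose inB x (Sx : x \in S) : B := exist _ x Sx.
pose C := [set y | connect (@edge B) (inB u Su) y].
have Cu : inB u Su \in C by rewrite inE.
have Cv : inB v Sv \in C by rewrite inE connect1.
have Ca : inB a Sa \in C by rewrite inE; apply: connect1; rewrite edge_sym.
have Cb : inB b Sb \in C.
  by rewrite inE; apply: (@connect_trans _ _ (inB v Sv)); apply: connect1.
have [q isoC] := comp _ _ (col u v uv) C (components_connect _).
pose inC y (Cy : y \in C) : induced C := exist _ y Cy.
have := @star_no_path4 _ q (inC _ Ca) (inC _ Cu) (inC _ Cv) (inC _ Cb) isoC au uv vb.
by case=> [[/eqP]|[/eqP]]; [left|right]; apply/eqP.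
Qed.

Lemma isomorphic_star (H : sgraph) p (c : H) :
  #|H| = p.+1 -> (forall x y : H, edge x y = ((x == c) != (y == c))) ->
  isomorphic H (star p).
Proof.
move=> cardH edgeE.
have cardA : #|{: {x : H | x != c}}| = p.
  by rewrite card_sig; have := cardC1 c; rewrite cardH.
(* [insub] fails exactly at [c], so [c] goes to the centre [None]. *)
pose h (x : H) : star p := omap (cast_ord cardA \o enum_rank) (insub x).
have hN x : (h x == None) = (x == c).
  by rewrite /h; case: insubP => [u /negPf -> //|/negPn ->].
exists h => [|u v]; last by rewrite edgeE -!hN.
apply: inj_card_bij; last by rewrite card_option card_ord cardH.
move=> x y; rewrite /h.
case: insubP => [u _ <-|/negPn/eqP ->]; case: insubP => [v _ <-|/negPn/eqP ->] //=.
by case=> /ord_inj/enum_rank_inj ->.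
Qed.

(* An orientation in which every arc ends in a sink and out-degrees are at most
   one makes each component a star around its sink. *)
Section StarForest.
Variables (H : sgraph) (a : rel H).
Hypothesis edgeE : forall x y, edge x y = a x y || a y x.
Hypothesis a_sink : forall x y z, a x y -> ~~ a y z.
Hypothesis a_fun : forall x y z, a x y -> a x z -> y = z.

(** A sink is its own centre, hence the default [x]. *)
Let centre x := odflt x [pick y | a x y].

Let centre_arc x y : a x y -> centre x = y.
Proof.
rewrite /centre => axy; case: pickP => [z axz|/(_ y)]; last by rewrite axy.
exact: a_fun axz axy.
Qed.

Let centre_sink x : (forall y, ~~ a x y) -> centre x = x.
Proof.
by rewrite /centre => sx; case: pickP => // y axy; have := sx y; rewrite axy.
Qed.

Let centreP x : centre x = x /\ (forall y, ~~ a x y) \/ a x (centre x).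
Proof.
rewrite /centre; case: pickP => [y|nx] /=; first by right.
by left; split=> // y; rewrite nx.
Qed.

(** Both ends of an edge have the same [centre], and each vertex is connected to its own, so
    components are the fibres of [centre]. *)
Let connect_centre x y : connect (@edge H) x y = (centre x == centre y).
Proof.
have edge_centre u v : edge u v -> centre u = centre v.
  rewrite edgeE => /orP[] uv;
  by rewrite (centre_arc uv) centre_sink // => z; apply: a_sink uv.
have to_centre u : connect (@edge H) u (centre u).
  by case: (centreP u) => [[-> _]//|au]; apply: connect1; rewrite edgeE au.
apply/idP/eqP => [/connectP[s + ->]|eq_c].
  elim: s x => //= z s IHs x /andP[/edge_centre -> /IHs]; exact.
apply: connect_trans (to_centre x) _; rewrite eq_c.
have symc : connect_sym (@edge H) by apply: sym_connect_sym; apply: edge_sym.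
by rewrite symc.
Qed.

Lemma star_forest_component p (C : {set H}) :
  (forall y, (forall z, ~~ a y z) -> #|[set x | a x y]| = p) ->
  C \in components H -> isomorphic (induced C) (star p).
Proof.
move=> deg /componentsP[x0 defC].
pose c := centre x0.
have sink_c z : ~~ a c z.
  rewrite /c; case: (centreP x0) => [[-> //]|ax0]; exact: a_sink ax0.
have CE y : (y \in C) = (centre y == c) by rewrite defC inE connect_centre eq_sym.
have Cc : c \in C by rewrite CE centre_sink.
have CU : C = c |: [set x | a x c].
  apply/setP => y; rewrite CE !inE; apply/eqP/orP => [cy|[/eqP ->|/centre_arc //]].
    by case: (centreP y) => [[<- _]|ay]; [left; rewrite cy|right; rewrite -cy].
  exact: centre_sink.
apply: (@isomorphic_star _ p (exist _ c Cc : induced C)).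
  by rewrite /= card_sig CU cardsU1 inE (negPf (sink_c c)) deg.
move=> [u Cu] [v Cv]; rewrite /edge /= /induced_edge /= -!val_eqE /= edgeE.
move: Cu Cv; rewrite CU !inE.
have [->|_] := eqVneq u c; have [->|_] := eqVneq v c => //=.
- by rewrite orbb (negPf (sink_c c)).
- by move=> _ ->; rewrite orbT.
- by move=> ->.
move=> au av; apply/negP => /orP[/(a_sink c)|/(a_sink c)].
  by rewrite av.
by rewrite au.
Qed.

End StarForest.

(** * Degree counting from conditions (i) and (ii) of a MINI-orientation *)

Section Counting.
Variables (p : nat) (hp : 2 <= p) (G : sgraph) (hG : regular G (2 * p)).
Variables (o : orientation G) (f : G -> 'I_(p + 2)).
Hypothesis col : colouring f.
Hypothesis in_out : forall v w u : G, orient o v w -> orient o u v -> f w != f u.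
Hypothesis out_inj : forall v w u : G, orient o v w -> orient o v u -> f w = f u -> w = u.

Let out_of (v : G) : {set G} := [set w | orient o v w].
Let in_of (v : G) : {set G} := [set w | orient o w v].

Let degree_split v : #|out_of v| + #|in_of v| = 2 * p.
Proof.
rewrite -(hG v) -cardsUI.
rewrite (_ : out_of v :&: in_of v = set0) ?cards0 ?addn0.
  by apply: eq_card => w; rewrite !inE (orient_edge o).
by apply/setP => w; rewrite !inE; apply/negbTE/orient_oriented.
Qed.

Let colours_split v : #|out_of v| + #|f @: in_of v| <= p.+1.
Proof.
have <- : #|f @: out_of v| = #|out_of v|.
  by apply: card_in_imset => w u; rewrite !inE; apply: out_inj.
rewrite -cardsUI (_ : _ :&: _ = set0) ?cards0 ?addn0; last first.
  apply/setP => k; rewrite !inE; apply/negbTE/negP => /andP[].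
  case/imsetP=> w; rewrite inE => vw -> /imsetP[u]; rewrite inE => uv /eqP.
  by apply/negP; apply: in_out uv.
have : f @: out_of v :|: f @: in_of v \subset [set~ f v].
  rewrite subUset; apply/andP; split; apply/subsetP => k /imsetP[w].
    by rewrite !inE => vw ->; rewrite eq_sym col // (orient_edge o) vw.
  by rewrite !inE => vw ->; rewrite col // (orient_edge o) vw.
by move/subset_leq_card/leq_trans; apply; rewrite cardsC1 card_ord addn2.
Qed.

Let in_colours_gt0 v : 0 < #|f @: in_of v|.
Proof.
rewrite card_gt0 imset_eq0; apply/eqP => in0.
have := colours_split v; have := degree_split v.
rewrite in0 imset0 !cards0 !addn0 => ->.
(* Without in-neighbours, 2p <= p + 1, against p >= 2. *)
by rewrite mul2n -addnn -addn1 leq_add2l leqNgt hp.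
Qed.

Let outdegree_le v : #|out_of v| <= p.
Proof.
have := colours_split v; case: #|f @: in_of v| (in_colours_gt0 v) => // a _.
by rewrite addnS ltnS; apply: leq_trans; apply: leq_addr.
Qed.

Lemma outdegree v : #|[set w | orient o v w]| = p.
Proof.
have sum_out_in : \sum_v #|out_of v| = \sum_v #|in_of v|.
  under eq_bigr do rewrite -sum1dep_card.
  under [RHS]eq_bigr do rewrite -sum1dep_card.
  by rewrite (exchange_big_dep predT).
have sum_out : \sum_v #|out_of v| = \sum_(v : G) p.
  (* Twice the sum of out-degrees is the sum of all degrees, 2p per vertex. *)
  apply: double_inj; rewrite -addnn {2}sum_out_in -big_split /=.
  under eq_bigr do rewrite degree_split.
  by rewrite -mul2n big_distrr.
(* Termwise bounds whose sums agree are equalities at each term. *)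
have le_p u : #|out_of u| <= p ?= iff (#|out_of u| == p).
  by split; first exact: outdegree_le.
have [_] := leqif_sum (fun u (_ : true) => le_p u).
by rewrite sum_out eqxx => /esym/forallP/(_ v)/eqP.
Qed.

Lemma indegree v : #|[set w | orient o w v]| = p.
Proof.
have := degree_split v; rewrite {1}/out_of outdegree mul2n -addnn.
exact: addnI.
Qed.

(** The p out-colours leave only one of the p + 1 colours other than [f v]. *)
Lemma in_neighbours_monochromatic v u w : orient o u v -> orient o w v -> f u = f w.
Proof.
move=> uv wv; have := colours_split v.
rewrite {1}/out_of outdegree -[p.+1]addn1 leq_add2l => le1.
by apply: (card_le1_eqP le1); apply: imset_f; rewrite inE.
Qed.

End Counting.

(** * Orienting a star colouring *)

Section StarOrientation.
Variables (G : sgraph) (k : nat) (f : G -> 'I_k).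
Hypothesis star_f : star_colouring f.

Let nb (v : G) c : {set G} := [set w | edge v w && (f w == c)].

(* The arc points to the centre of the bicoloured component of uv; the
   enumeration order decides for K_{1,1}, where the centre is ambiguous. *)
Definition star_orient : rel G := fun u v =>
  edge u v && ((1 < #|nb v (f u)|) ||
               (#|nb u (f v)| <= 1) && (enum_rank u < enum_rank v)).

(** Otherwise [u] has a neighbour [a] other than [v] coloured [f v], and [v] a neighbour [b] other
    than [u] coloured [f u]; the path a, u, v, b is then bicoloured. *)
Let nb_le1 u v : edge u v -> (#|nb u (f v)| <= 1) || (#|nb v (f u)| <= 1).
Proof.
move=> uv; rewrite !(leqNgt _ 1) -negb_and; apply/negP => /andP[].
move=> /card_gt1P[a1 [a2 [+ + a12]]] /card_gt1P[b1 [b2 [+ + b12]]].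
rewrite !inE => /andP[ua1 /eqP fa1] /andP[ua2 /eqP fa2].
move=> /andP[vb1 /eqP fb1] /andP[vb2 /eqP fb2].
have [a [ua fa av]] : exists a, [/\ edge u a, f a = f v & a != v].
  have [a1v|] := eqVneq a1 v; last by exists a1.
  by exists a2; split=> //; rewrite -a1v eq_sym.
have [b [vb fb bu]] : exists b, [/\ edge v b, f b = f u & b != u].
  have [b1u|] := eqVneq b1 u; last by exists b1.
  by exists b2; split=> //; rewrite -b1u eq_sym.
have au : edge a u by rewrite edge_sym.
have [eq_av|eq_ub] := star_colouring_no_path4 star_f au uv vb fa fb.
  by rewrite eq_av eqxx in av.
by rewrite eq_ub eqxx in bu.
Qed.

(** The tail [u] is a leaf of the bicoloured component of [uv]. *)
Lemma star_orient_nb u v w :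
  star_orient u v -> edge u w -> f w = f v -> w = v.
Proof.
case/andP=> uv uvP uw fw.
have le1 : #|nb u (f v)| <= 1.
  case/orP: uvP => [gt1|/andP[]//].
  by have := nb_le1 uv; rewrite [X in _ || X]leqNgt gt1 orbF.
by apply: (card_le1_eqP le1); rewrite !inE ?uw ?uv ?fw eqxx.
Qed.

Lemma star_orient_oriented : is_oriented star_orient.
Proof.
move=> u v; apply/negP => /andP[/andP[uv uvP] /andP[_ vuP]].
have := nb_le1 uv; move: uvP vuP; rewrite !(leqNgt _ 1).
case: (1 < #|nb v _|); case: (1 < #|nb u _|) => //= ruv rvu _.
by have := ltn_trans ruv rvu; rewrite ltnn.
Qed.

Lemma star_orient_edge u v : edge u v = star_orient u v || star_orient v u.
Proof.
rewrite /star_orient [edge v u]edge_sym; case uv: (edge u v) => //=.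
have neq_uv : u != v by apply/eqP => eq_uv; rewrite eq_uv edge_irrefl in uv.
rewrite !(leqNgt _ 1); case: (1 < #|nb v _|); case: (1 < #|nb u _|) => //=.
by rewrite -neq_ltn (inj_eq (@ord_inj _)) (inj_eq enum_rank_inj) neq_uv.
Qed.

Definition star_orientation : orientation G :=
  Orientation star_orient_oriented star_orient_edge.

End StarOrientation.

Lemma star_colouring_MINI p (G : sgraph) (f : G -> 'I_(p + 2)) :
  2 <= p -> regular G (2 * p) -> forall star_f : star_colouring f,
  MINI_orientation (star_orientation star_f) f.
Proof.
move=> hp hG star_f; have col := star_f.1; set o := star_orientation star_f.
have in_out (v w u : G) : orient o v w -> orient o u v -> f w != f u.
  (* If [w] and [u] shared a colour, the arc from [v] to [w] would force [u = w], so one edge would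
     be oriented both ways. *)
  move=> vw uv; apply/eqP => fwu.
  have vu : edge v u by rewrite (orient_edge o) uv orbT.
  have uw := star_orient_nb star_f vw vu (esym fwu).
  by have := orient_oriented o u v; rewrite uv uw vw.
have out_inj (v w u : G) : orient o v w -> orient o v u -> f w = f u -> w = u.
  move=> vw vu fwu; apply: (star_orient_nb star_f vu) => //.
  by rewrite (orient_edge o) vw.
split=> // v; split=> [w u|w u|u w]; rewrite !inE.
- exact: in_out.
- exact: out_inj.
- exact: (in_neighbours_monochromatic hp hG col in_out out_inj).
Qed.

(** * From a MINI-orientation to an OBH *)

Lemma MINI_OBH p (G : sgraph) (o : orientation G) (f : G -> 'I_(p + 2)) :
  2 <= p -> regular G (2 * p) -> MINI_orientation o f ->
  exists psi : o -> oline_K (p + 2), OBH psi.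
Proof.
move=> hp hG [col mini].
have in_out (v w u : G) : orient o v w -> orient o u v -> f w != f u.
  by move=> vw uv; case: (mini v) => /(_ w u) + _ _; apply; rewrite inE.
have out_inj (v w u : G) : orient o v w -> orient o v u -> f w = f u -> w = u.
  by move=> vw vu; case: (mini v) => _ + _; apply; rewrite inE.
have in_col (v u w : G) : orient o u v -> orient o w v -> f u = f w.
  by move=> uv wv; case: (mini v) => _ _; apply; rewrite inE.
have ex_in (v : G) : exists u, orient o u v.
  have : 0 < #|[set u | orient o u v]|.
    by rewrite (indegree hp hG col in_out out_inj) ltnW.
  by case/card_gt0P => u; rewrite inE; exists u.
(* An arbitrary in-neighbour; by condition (iii) its colour does not depend on the choice. *)
pose pre v := xchoose (ex_in v).
have preP v : orient o (pre v) v := xchooseP (ex_in v).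
have preE u v : orient o u v -> f (pre v) = f u by move=> uv; apply: in_col uv.
have pre_neq v : f (pre v) != f v by rewrite col // (orient_edge o) preP.
pose psi (v : o) : oline_K (p + 2) :=
  exist (fun x : _ * _ => x.1 != x.2) (f (pre v), f v) (pre_neq v).
have psi_inj (v : G) : {in out_nbrs (v : o) &, injective psi}.
  by move=> w u; rewrite !inE => vw vu [_]; apply: out_inj vu.
(* Surjectivity by counting: [v] has p out-neighbours with distinct images, and an out-neighbour of
   (i, j) is fixed by its second entry, which avoids i and j. *)
exists psi => v; split=> //; apply/eqP; rewrite eqEcard; apply/andP; split.
  apply/subsetP => _ /imsetP[w + ->]; rewrite !inE /= => vw.
  by rewrite /oline_arc /= (preE _ _ vw) eqxx (in_out _ _ _ vw (preP v)).
rewrite (card_in_imset (@psi_inj v)) /out_nbrs.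
rewrite (outdegree hp hG col in_out out_inj).
have snd_inj : {in out_nbrs (psi v) &, injective (fun x : oline_K (p + 2) => (val x).2)}.
  move=> [[x1 x2] ?] [[y1 y2] ?]; rewrite !inE /oline_arc /=.
  by move=> /andP[/eqP/= eqx _] /andP[/eqP/= eqy _] eq2; apply: val_inj; rewrite /= eq2 eqx eqy.
rewrite -(card_in_imset snd_inj).
have sub : [set (val x).2 | x in out_nbrs (psi v)] \subset ~: [set f (pre v); f v].
  apply/subsetP => _ /imsetP[[[x1 x2] /= x12] + ->]; rewrite !inE /oline_arc /=.
  move=> /andP[/eqP/= eqx x2_neq]; rewrite negb_or x2_neq /=.
  by rewrite -eqx eq_sym.
apply: leq_trans (subset_leq_card sub) _.
have := cardsC [set f (pre v); f v].
by rewrite cards2 pre_neq card_ord addnC => /addIn ->.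
Qed.

(** * From an OBH to bicoloured components K_{1,p} *)

Section FromOBH.
Variables (p : nat) (hp : 2 <= p) (G : sgraph) (hG : regular G (2 * p)).
Variables (o : orientation G) (psi : o -> oline_K (p + 2)) (obh : OBH psi).

Let f (v : G) : 'I_(p + 2) := (val (psi v)).2.
(** The common colour of the in-neighbours of [v], by [arcP]. *)
Let g (v : G) : 'I_(p + 2) := (val (psi v)).1.

Let g_neq v : g v != f v. Proof. exact: valP (psi v). Qed.

Let arcP u v : orient o u v -> f u = g v /\ f v != g u.
Proof.
move=> uv; have : psi v \in out_nbrs (psi u).
  by rewrite -(obh u).2 imset_f // inE.
by rewrite inE => /andP[/eqP/esym ? ?].
Qed.

(** This is surjectivity of [psi] on out-neighbourhoods, applied to the target [(f u, c)]. *)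
Let arc_exists u c : c != g u -> c != f u -> exists2 w, orient o u w & f w = c.
Proof.
move=> cg; rewrite eq_sym => cf; pose x : oline_K (p + 2) :=
  exist (fun x : _ * _ => x.1 != x.2) (f u, c) cf.
have : x \in out_nbrs (psi u) by rewrite inE /= /oline_arc /= eqxx.
rewrite -(obh u).2 => /imsetP[w]; rewrite inE => uw xw.
by exists w => //; rewrite /f -xw.
Qed.

Let col : colouring f.
Proof.
move=> u v; rewrite (orient_edge o) => /orP[] /arcP[-> _]; first exact: g_neq.
by rewrite eq_sym g_neq.
Qed.

Let in_out (v w u : G) : orient o v w -> orient o u v -> f w != f u.
Proof. by move=> /arcP[_ fw] /arcP[-> _]. Qed.

Let out_inj (v w u : G) : orient o v w -> orient o v u -> f w = f u -> w = u.
Proof.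
move=> vw vu fwu; apply: (obh v).1; rewrite ?inE //; apply: val_inj.
rewrite [LHS]surjective_pairing [RHS]surjective_pairing; congr pair => //.
by rewrite -[LHS](arcP vw).1 (arcP vu).1.
Qed.

Lemma OBH_star_colouring :
  exists f : G -> 'I_(p + 2), colouring f /\
    all_bicoloured_components f (fun C => isomorphic C (star p)).
Proof.
exists f; split=> // i j neq_ij C.
pose a : rel (bicoloured f i j) := fun x y => orient o (val x) (val y).
have two_colours (x y z : bicoloured f i j) :
    f (val x) != f (val y) -> f (val y) != f (val z) -> f (val x) = f (val z).
  move: (valP x) (valP y) (valP z); rewrite !inE.
  by do 3![case/orP => /eqP ->]; rewrite ?eqxx.
have arc_neq (x y : G) : orient o x y -> f x != f y.
  by move=> xy; apply: col; rewrite (orient_edge o) xy.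
apply: (@star_forest_component _ a).
- by move=> x y; exact: (orient_edge o (val x) (val y)).
(* With two colours, consecutive arcs x, y, z would give [f x = f z], against [in_out]. *)
- move=> x y z xy; apply/negP => yz; have := in_out yz xy.
  by rewrite (two_colours x y z) ?eqxx ?arc_neq.
- move=> x y z xy xz; apply: val_inj; apply: (out_inj xy xz).
  by apply: (two_colours y x z); [rewrite eq_sym|]; apply: arc_neq.
move=> y sink_y.
have Sg : (g (val y) == i) || (g (val y) == j).
  (* The colour of the pair other than that of [y]: if it were not [g y], then [y] would have an
     out-neighbour coloured [c] and not be a sink. *)
  pose c := if f (val y) == i then j else i.
  have Sc : (c == i) || (c == j) by rewrite /c; case: ifP; rewrite eqxx ?orbT.
  have cf : c != f (val y).
    by rewrite /c; have [->|] := eqVneq (f (val y)) i; rewrite eq_sym.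
  have [<- //|cg] := eqVneq c (g (val y)).
  have [w yw fw] := arc_exists cg cf.
  have Sw : w \in [set x : G | (f x == i) || (f x == j)] by rewrite inE fw.
  by have := sink_y (exist _ w Sw); rewrite /a yw.
(* All p in-neighbours of [y] in [G] are coloured [g y], hence lie in the bicoloured subgraph. *)
rewrite -[RHS](indegree hp hG col in_out out_inj (val y)).
rewrite -(card_imset _ val_inj); apply: eq_card => u; rewrite inE.
apply/imsetP/idP => [[x + ->]|uy]; first by rewrite inE.
have Su : u \in [set x : G | (f x == i) || (f x == j)].
  by rewrite inE (arcP uy).1.
by exists (exist _ u Su); rewrite ?inE.
Qed.

End FromOBH.

Theorem theorem7 (p : nat) (hp : 2 <= p) (G : sgraph)
    (hG : regular G (2 * p)) :
  [<-> (* I *)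
       exists f : G -> 'I_(p + 2), star_colouring f;
       (* II *)
       exists (o : orientation G) (f : G -> 'I_(p + 2)), MINI_orientation o f;
       (* III *)
       exists (o : orientation G) (psi : o -> oline_K (p + 2)), OBH psi;
       (* IV *)
       exists f : G -> 'I_(p + 2),
         colouring f /\
         all_bicoloured_components f (fun C => isomorphic C (star p))].
Proof.
tfae.
- case=> f star_f; exists (star_orientation star_f), f.
  exact: star_colouring_MINI.
- by case=> o [f mini]; exists o; apply: MINI_OBH mini.
- by case=> o [psi obh]; apply: OBH_star_colouring obh.
case=> f [col comp]; exists f; split=> // i j neq_ij C CB.
by exists p; apply: comp.
Qed.
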